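(* Let $r\ge 2$, let $k_1,\dots,k_r\ge 1$ be integers, let $0\le\delta\le \frac{1}{2(r+1)}$, and let $G$ be a graph with $n$ vertices and at least $(1-\delta)\binom{n}{2}$ edges. Let $k:=\max\{k_1,\dots,k_r\}$ and suppose that $\big(1-(r+1)\delta\big)n\ge \sum_{i=1}^r (k_i-1)+k+1$. Then for every $r$-colouring of the edges of $G$ there is $1\le i\le r$ such that $G$ contains a matching of size $k_i$ all of whose edges have colour $i$. *)

(* Defs.v *)
From HB Require Import structures.
From mathcomp Require Import all_boot all_order all_algebra.
Set Implicit Arguments.
Unset Strict Implicit.
Unset Printing Implicit Defensive.

Import Order.TTheory GRing.Theory Num.Theory.

Record sgraph (T : finType) := SGraph {
  adj :> rel T;
  adj_sym : symmetric adj;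
  adj_irrefl : irreflexive adj
}.

Definition edges (T : finType) (G : sgraph T) : {set {set T}} :=
  [set [set p.1; p.2] | p : T * T & G p.1 p.2].

(* The edges of [M] are nonempty, so [trivIset] is pairwise vertex-disjointness. *)
Definition matching (T : finType) (G : sgraph T) (M : {set {set T}}) : bool :=
  (M \subset edges G) && trivIset M.

(* An [r]-colouring of the edges is represented by a function on all vertex
   sets, of which only the values on [edges G] are ever used. *)
Definition has_mono_matching (T : finType) (G : sgraph T) (r : nat)
    (c : {set T} -> 'I_r) (i : 'I_r) (m : nat) : Prop :=
  exists M : {set {set T}},
    [/\ matching G M, #|M| = m & {in M, forall e, c e = i}].

(* Main.v *)
(* Suppose that no colour [i] has a matching of size [k_i]. By Tutte-Berge there
   is for each colour a vertex set [S_i] such that [|S_i| + m_i <= k_i - 1], where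
   [m_i] is the matching number of colour [i] outside [S_i], and the components
   left by [S_i] are so small that colour [i] has at most [m_i (2 m_i + 1)] edges
   outside [S_i]. Outside the union of the [S_i] there are thus at most
   [sum_i m_i (2 k - 1)] edges, which is too few for a graph missing at most a
   [delta]-fraction of the pairs.

   The set [S_i] is taken maximal such that deleting it lowers the matching number
   by at least [|S_i|]. Every remaining vertex is then missed by a maximum
   matching, and by Gallai's lemma "no maximum matching misses both" is an
   equivalence relation on them, so that a maximum matching covers all but at
   most one vertex of each class. *)
Require Import Defs.
From mathcomp Require Import all_boot all_order all_algebra.
From mathcomp Require Import zify lra.
Set Implicit Arguments.
Unset Strict Implicit.
Unset Printing Implicit Defensive.

Import Order.TTheory GRing.Theory Num.Theory.

(** * Matchings as involutions, and the exchange of edges *)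

Section InvolutiveMatching.
Context {T : finType}.
Implicit Types (E : rel T) (f g : {ffun T -> T}).

(* A matching is encoded by the involution exchanging the ends of each of its
   edges and fixing the uncovered vertices. *)
Definition inv_matching E f : bool :=
  [forall x, (f (f x) == x) && ((f x == x) || E x (f x))].

Definition covered f : {set T} := [set x | f x != x].

Definition max_matching E f : bool :=
  inv_matching E f &&
  [forall g, inv_matching E g ==> (#|covered g| <= #|covered f|)%N].

(* Adds the edge [x y], at an uncovered vertex [x], and drops the edge of [f]
   at [y], if there is one. *)
Definition exchange f (x y : T) : {ffun T -> T} :=
  [ffun u => if u == x then y else if u == y then x
             else if u == f y then u else f u].

Lemma inv_matchingP E f :
  reflect ((forall x, f (f x) = x) /\ (forall x, f x != x -> E x (f x)))
          (inv_matching E f).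
Proof.
apply: (iffP forallP) => [h|[h1 h2] x].
  split=> x; have /andP[/eqP ffx e] := h x; first exact: ffx.
  by move=> nx; move: e; rewrite (negbTE nx).
by rewrite h1 eqxx /=; case: eqP => //= /eqP; apply: h2.
Qed.

Lemma max_matchingP E f :
  reflect (inv_matching E f /\
           forall g, inv_matching E g -> (#|covered g| <= #|covered f|)%N)
          (max_matching E f).
Proof.
apply: (iffP andP) => -[mf h]; split=> //.
  by move=> g mg; move/forallP/(_ g)/implyP: h; apply.
by apply/forallP => g; apply/implyP; apply: h.
Qed.

Lemma exchange_matching E f x y : symmetric E -> inv_matching E f ->
  f x = x -> x != y -> E x y -> inv_matching E (exchange f x y).
Proof.
move=> symE /inv_matchingP[ff fE] fx nxy Exy.
have inj : injective f by move=> a b e; rewrite -(ff a) e ff.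
apply/inv_matchingP; split=> u; rewrite !ffunE.
  have [->|ux] := eqVneq u x; first by rewrite eqxx eq_sym (negbTE nxy).
  have [->|uy] := eqVneq u y; first by rewrite eqxx.
  have [uf|uf] := eqVneq u (f y).
    by rewrite (negbTE ux) (negbTE uy) uf eqxx.
  have -> : (f u == x) = false.
    by apply/eqP=> e; case/eqP: ux; rewrite -(ff u) e fx.
  have -> : (f u == y) = false.
    by apply/eqP=> e; case/eqP: uf; rewrite -(ff u) e.
  have -> : (f u == f y) = false by apply/eqP=> /inj e; case/eqP: uy.
  exact: ff.
have [->|ux] := eqVneq u x; first by [].
have [->|uy] := eqVneq u y; first by rewrite symE.
have [uf|uf] := eqVneq u (f y); first by rewrite eqxx.
exact: fE.
Qed.

Lemma exchange_covered f x y : f x = x -> x != y -> f (f y) = y ->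
  covered (exchange f x y) = x |: (y |: (covered f :\ f y)).
Proof.
move=> fx nxy ffy; apply/setP=> u; rewrite !inE ffunE.
have [->|ux] := eqVneq u x; first by rewrite eq_sym nxy.
have [->|uy] := eqVneq u y; first by rewrite nxy.
by have [uf|uf] := eqVneq u (f y); rewrite ?eqxx.
Qed.

Lemma card_exchange_uncovered f x y : f x = x -> f y = y -> x != y ->
  #|covered (exchange f x y)| = #|covered f|.+2.
Proof.
move=> fx fy nxy; rewrite exchange_covered ?fy // !cardsU1 !inE eqxx.
rewrite (negbTE nxy) fx eqxx andbF /= [in RHS](cardsD1 y) inE fy eqxx.
by rewrite !add1n.
Qed.

Lemma card_exchange_covered f x y : f (f y) = y -> f x = x -> f y != y ->
  x != y -> #|covered (exchange f x y)| = #|covered f|.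
Proof.
move=> ffy fx fy nxy; rewrite exchange_covered // cardsU1.
have -> : y |: covered f :\ f y = covered f :\ f y.
  by apply/setUidPr; rewrite sub1set !inE fy eq_sym fy.
by rewrite !inE fx eqxx andbF (cardsD1 (f y) (covered f)) inE ffy eq_sym fy.
Qed.

Definition edge_set f : {set {set T}} := [set [set x; f x] | x in covered f].

Lemma edge_set_triv f : involutive f -> trivIset (edge_set f).
Proof.
move=> ff.
have pairE z x : z \in [set x; f x] -> [set x; f x] = [set z; f z].
  by rewrite !inE => /orP[]/eqP-> //; rewrite ff setUC.
apply/trivIsetP=> _ _ /imsetP[x _ ->] /imsetP[y _ ->] nxy.
apply: contraR nxy => /pred0Pn[z /= /andP[/pairE-> /pairE->]].
exact: eqxx.
Qed.

Lemma card_covered f : involutive f -> #|covered f| = (2 * #|edge_set f|)%N.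
Proof.
move=> ff; have -> : covered f = cover (edge_set f).
  apply/setP=> x; apply/idP/bigcupP => [cx|[_ /imsetP[y cy ->]]].
    by exists [set x; f x]; rewrite ?inE ?eqxx //; apply: imset_f.
  move: cy; rewrite !inE => cy /orP[]/eqP-> //.
  by rewrite ff eq_sym.
rewrite -(eqP (edge_set_triv ff)) mulnC -sum_nat_const.
apply: eq_bigr => _ /imsetP[x cx ->].
by rewrite cards2; move: cx; rewrite inE eq_sym => ->.
Qed.

End InvolutiveMatching.

(** * Gallai's lemma and the edge bound of Tutte-Berge type *)

Section Gallai.
Context {T : finType}.
Implicit Types (E : rel T) (f g : {ffun T -> T}).

Lemma max_matching_exists E : exists f, max_matching E f.
Proof.
have m0 : inv_matching E [ffun x => x].
  by apply/inv_matchingP; split=> x; rewrite !ffunE ?eqxx.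
case: (@arg_maxnP _ _ (inv_matching E) (fun f => #|covered f|) m0) => f mf h.
by exists f; apply/max_matchingP; split=> // g /h.
Qed.

(* If some maximum matching [f] misses [u] and [v] and a maximum matching [g]
   missing [t] is chosen to agree with [f] on as many vertices as possible, then
   an edge of [f] can be exchanged into [g], which is a contradiction. *)
Lemma gallai_trans E u t v : symmetric E ->
  (exists2 g, max_matching E g & g t = t) ->
  (forall g, max_matching E g -> g u = u -> g t != t) ->
  (forall g, max_matching E g -> g v = v -> g t != t) ->
  u != v -> forall f, max_matching E f -> f u = u -> f v != v.
Proof.
move=> symE [g0 mg0 g0t] hut hvt nuv f mf fu; apply/negP=> /eqP fv.
have P0 : max_matching E g0 && (g0 t == t) by rewrite mg0 g0t eqxx.
case: (@arg_maxnP _ g0 (fun g => max_matching E g && (g t == t))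
  (fun g => #|[set a | f a == g a]|) P0) => g /andP[mg /eqP gt] gmax.
have ft : f t != t by apply: hut.
have gu : g u != u.
  by apply/negP=> /eqP gu; have := hut g mg gu; rewrite gt eqxx.
have gv : g v != v.
  by apply/negP=> /eqP gv; have := hvt g mg gv; rewrite gt eqxx.
have [mf1 mf2] := max_matchingP _ _ mf; have [mg1 mg2] := max_matchingP _ _ mg.
have ecard : #|covered f| = #|covered g|.
  by apply/eqP; rewrite eqn_leq mg2 ?mf2.
(* Both matchings cover equally many vertices, and [u], [v] are covered by [g] only. So at least two
   vertices are covered by [f] only: [t] and some further [x]. *)
have [x [xt fx gx]] : exists x, [/\ x != t, f x != x & g x = x].
  have : (1 < #|covered f :\: covered g|)%N.
    suff : (1 < #|covered g :\: covered f|)%N.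
      by rewrite !cardsD ecard setIC.
    rewrite -[2%N](_ : #|[set u; v]| = _); last by rewrite cards2 nuv.
    apply: subset_leq_card; apply/subsetP=> a.
    by rewrite !inE => /orP[]/eqP->; rewrite ?fu ?fv eqxx ?gu ?gv.
  rewrite (cardsD1 t) => h.
  have /card_gt0P[x] : (0 < #|(covered f :\: covered g) :\ t|)%N.
    by move: h; case: (t \in _) => //; apply: ltn_trans.
  rewrite !inE negbK => /and3P[xt /eqP gx fx].
  by exists x; split.
have [ff fE] := inv_matchingP _ _ mf1; have [gg gE] := inv_matchingP _ _ mg1.
have nxy : x != f x by rewrite eq_sym.
pose h := exchange g x (f x).
have mh : inv_matching E h by apply: exchange_matching => //; apply: fE.
have [gy|gy] := eqVneq (g (f x)) (f x).
  by have := mg2 h mh; rewrite card_exchange_uncovered // ltnNge leqnSn.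
have hcard : #|covered h| = #|covered g|.
  by rewrite card_exchange_covered.
have mmh : max_matching E h.
  by apply/max_matchingP; split=> // g' mg'; rewrite hcard mg2.
have ht : h t = t.
  rewrite ffunE eq_sym (negbTE xt).
  have -> : (t == f x) = false by apply/eqP=> e; case/eqP: gy; rewrite -e gt.
  by case: ifP.
have := gmax h; rewrite mmh ht eqxx => /(_ isT).
(* [h] agrees with [f] wherever [g] does, and also at [x]. At the newly uncovered [g (f x)] nothing
   is lost: if [f] and [g] agreed there, their common value would be [f x], forcing
   [g (f x) = x]. *)
apply/negP; rewrite -ltnNge; apply: proper_card; apply/properP; split.
  apply/subsetP=> a; rewrite !inE ffunE => fga.
  have [->|ax] := eqVneq a x; first by [].
  have [->|ay] := eqVneq a (f x); first by rewrite ff.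
  have [az|//] := eqVneq a (g (f x)).
  by move: fga; rewrite az gg (inj_eq (inv_inj ff)) -az (negbTE ax).
exists x; first by rewrite inE ffunE eqxx.
by rewrite inE gx.
Qed.

(** Ordered pairs count each edge twice, so a bound of [m * (2 * m + 1)] edges appears doubled
    below. *)
Definition offdiag E : {set T * T} := [set p | E p.1 p.2 & p.1 != p.2].

(** Adjacent vertices are related, since joining them would enlarge a matching that misses both.
    Hence a covered vertex has at most [2 * m - 1] covered neighbours and one uncovered neighbour,
    and uncovered vertices are pairwise non-adjacent. Splitting by the first vertex gives at most
    [2 * m * (2 * m)] and [2 * m] pairs. *)
Lemma missable_pairs_bound E m f : symmetric E -> max_matching E f ->
  #|covered f| = (2 * m)%N ->
  (forall v, exists2 g, max_matching E g & g v = v) ->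
  (#|offdiag E| <= 2 * m * (2 * m + 1))%N.
Proof.
move=> symE mf cf miss.
have [mf1 _] := max_matchingP _ _ mf.
pose R u v := [forall g, (max_matching E g && (g u == u)) ==> (g v != v)].
have RP u v :
    reflect (forall g, max_matching E g -> g u = u -> g v != v) (R u v).
  apply: (iffP forallP) => [h g mg gu|h g].
    by move/implyP: (h g); apply; rewrite mg gu eqxx.
  by apply/implyP=> /andP[mg /eqP]; apply: h.
have Rsym u v : R u v -> R v u.
  move=> /RP h; apply/RP=> g mg gv; apply/negP=> /eqP gu.
  by have := h g mg gu; rewrite gv eqxx.
(* [R u u] fails, as some maximum matching misses [u]; hence the condition [u != v]. *)
have Rtrans u t v : u != v -> R u t -> R v t -> R u v.
  by move=> nuv /RP ut /RP vt; apply/RP; apply: (@gallai_trans E u t v).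
have ER x y : x != y -> E x y -> R x y.
  move=> nxy Exy; apply/RP=> g mg gx; apply/negP=> /eqP gy.
  have [mg1 mg2] := max_matchingP _ _ mg.
  have := mg2 _ (exchange_matching symE mg1 gx nxy Exy).
  by rewrite card_exchange_uncovered // ltnNge leqnSn.
have unc1 x : (#|[set y | R x y & f y == y]| <= 1)%N.
  rewrite leqNgt; apply/negP=> /card_gt1P[a [b [+ + nab]]].
  rewrite !inE => /andP[xa /eqP fa] /andP[xb /eqP fb].
  have /RP/(_ f mf fa) := Rtrans a x b nab (Rsym _ _ xa) (Rsym _ _ xb).
  by rewrite fb eqxx.
have row_card (A : {set T * T}) (B : {set T}) d :
    (forall p, p \in A -> p.1 \in B) ->
    (forall x, x \in B -> #|[set y | (x, y) \in A]| <= d)%N ->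
    (#|A| <= #|B| * d)%N.
  move=> AB Ad; rewrite -sum1_card (partition_big fst (mem B)) //=.
  rewrite -sum_nat_const; apply: leq_sum => x xB.
  rewrite sum1_card; apply: leq_trans (Ad x xB).
  rewrite -(card_imset (mem [set y | (x, y) \in A]) (f := pair x));
    last by move=> a b [].
  apply: subset_leq_card; apply/subsetP=> -[a b] /= /andP[].
  rewrite unfold_in /= => abA /eqP e; subst a.
  by apply/imsetP; exists b; rewrite ?inE.
pose A1 := [set p in offdiag E | p.1 \in covered f].
pose A2 := [set p in offdiag E | p.1 \notin covered f].
have card12 : #|offdiag E| = (#|A1| + #|A2|)%N.
  rewrite -(cardsID [set p | p.1 \in covered f] (offdiag E)).
  by congr (_ + _)%N; apply: eq_card => p; rewrite !inE // andbC.
have h1 : (#|A1| <= 2 * m * (2 * m))%N.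
  rewrite -{1}cf; apply: row_card => [p|x cx]; first by rewrite inE => /andP[].
  have : (#|(covered f :\ x) :|: [set y | R x y & f y == y]| <= 2 * m)%N.
    rewrite cardsU; have := cardsD1 x (covered f); rewrite cx cf.
    by have := unc1 x; lia.
  apply: leq_trans; apply: subset_leq_card; apply/subsetP=> y.
  rewrite !inE /= => /andP[/andP[Exy nxy] _].
  by rewrite eq_sym nxy (ER x y) //=; case: (f y == y).
have h2 : (#|A2| <= 2 * m)%N.
  (* Swapping puts the covered end first, so that [unc1] bounds each row by one. *)
  have -> : #|A2| = #|[set (p.2, p.1) | p in A2]|.
    by rewrite card_in_imset // => -[a b] [c d] _ _ [-> ->].
  rewrite -[(2 * m)%N]muln1 -{1}cf; apply: row_card.
    move=> _ /imsetP[[a b] + ->] /=; rewrite !inE /= negbK.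
    move=> /andP[/andP[Eab nab] /eqP fa].
    by move/RP: (ER a b nab Eab); apply.
  move=> y _; apply: leq_trans (unc1 y); apply: subset_leq_card.
  apply/subsetP=> x; rewrite inE => /imsetP[[a b] + [-> ->]].
  rewrite !inE /= negbK => /andP[/andP[Eab nab] ->].
  by rewrite andbT Rsym // ER.
by rewrite card12; nia.
Qed.

(** Deleted vertices stay in the type [T] as isolated vertices, which every matching misses. *)
Definition avoiding E (S : {set T}) : rel T :=
  fun x y => [&& E x y, x \notin S & y \notin S].

(** For a largest [S] satisfying [P], every vertex outside [S] is missable: otherwise deleting it
    too would cost the maximum matching an edge, and [v |: S] would satisfy [P]. *)
Lemma tutte_berge_pairs E k : symmetric E ->
  (forall f, inv_matching E f -> (#|covered f| <= 2 * k)%N) ->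
  exists (S : {set T}) (m : nat), (#|S| + m <= k)%N /\
    (#|offdiag (avoiding E S)| <= 2 * m * (2 * m + 1))%N.
Proof.
move=> symE hk.
pose P (S : {set T}) := [exists f, max_matching (avoiding E S) f &&
  (2 * #|S| + #|covered f| <= 2 * k)%N].
have P0 : P set0.
  have [f mf] := max_matching_exists (avoiding E set0).
  apply/existsP; exists f; rewrite mf cards0 /=; apply: hk.
  have [/inv_matchingP[ff fE] _] := max_matchingP _ _ mf.
  by apply/inv_matchingP; split=> // x /fE /and3P[].
case: (@arg_maxnP _ set0 P (fun S => #|S|) P0).
move=> S /existsP[f /andP[mf Sf]] Smax.
have symS : symmetric (avoiding E S).
  by move=> x y; rewrite /avoiding symE [(x \notin S) && _]andbC.
have [/inv_matchingP[ff _] fmax] := max_matchingP _ _ mf.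
have cf := card_covered ff.
exists S, #|edge_set f|; split; first by move: Sf; rewrite cf; lia.
apply: (@missable_pairs_bound _ _ f) => // v.
have [vS|vS] := boolP (v \in S).
  exists f => //; apply/eqP; apply: contraLR vS => fv.
  have [/inv_matchingP[_ fE] _] := max_matchingP _ _ mf.
  by case/and3P: (fE v fv).
have [g mg] := max_matching_exists (avoiding E (v |: S)).
have [/inv_matchingP[gg gE] _] := max_matchingP _ _ mg.
have mgS : inv_matching (avoiding E S) g.
  apply/inv_matchingP; split=> // x /gE /and3P[Ex]; rewrite !inE !negb_or.
  by move=> /andP[_ xS] /andP[_ gxS]; apply/and3P.
have gv : g v = v.
  by apply/eqP/negPn/negP=> /gE /and3P[_]; rewrite !inE eqxx.
exists g => //; apply/max_matchingP; split=> // h mh.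
(* Numbers of covered vertices are even, so a strict drop is at least 2 and pays for adding [v]. *)
apply: leq_trans (fmax h mh) _; rewrite leqNgt; apply/negP=> lt_gf.
have : P (v |: S).
  apply/existsP; exists g; rewrite mg cardsU1 vS /=.
  by move: Sf lt_gf; rewrite cf (card_covered gg); lia.
by move/Smax; rewrite cardsU1 vS; lia.
Qed.

End Gallai.

(** * Counting ordered pairs and passing to colour classes *)

Section Counting.
Context {T : finType}.
Implicit Types (G : sgraph T) (W : {set T}).

Definition offdiag_in W : {set T * T} :=
  [set p | [&& p.1 \in W, p.2 \in W & p.1 != p.2]].

Lemma card_offdiag_in W : (#|offdiag_in W| + #|W| = #|W| * #|W|)%N.
Proof.
rewrite -cardsX -(cardsID (offdiag_in W) (setX W W)); congr (_ + _)%N.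
  by apply: eq_card => p; rewrite !inE; case: (_ \in _); case: (_ \in _).
rewrite -(card_imset (mem W) (f := fun x => (x, x))); last by move=> a b [].
apply: eq_card => -[x y]; rewrite !inE /=; apply/imsetP/idP.
  by case=> z zW [-> ->]; rewrite zW eqxx.
case/andP=> h /andP[xW yW]; move: h.
by rewrite xW yW negbK /= => /eqP->; exists y.
Qed.

Lemma double_card_edges G : (2 * #|edges G| <= #|[set p | G p.1 p.2]|)%N.
Proof.
pose e (p : T * T) := [set p.1; p.2].
rewrite -[X in (_ <= X)%N]sum1_card.
rewrite (partition_big e (mem (edges G))) /=; last first.
  by move=> p; rewrite inE => Gp; apply/imsetP; exists p; rewrite ?inE.
rewrite mulnC -sum_nat_const; apply: leq_sum => _ /imsetP[[x y] + ->].
rewrite inE /= => Gxy.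
have nxy : x != y.
  by apply/eqP=> h; move: Gxy; rewrite h (adj_irrefl G).
rewrite sum1_card -[2%N](_ : #|[set (x, y); (y, x)]| = _); last first.
  by rewrite cards2 xpair_eqE negb_and nxy.
apply: subset_leq_card; apply/subsetP=> p; rewrite !inE unfold_in /e /=.
by case/orP=> /eqP-> /=; rewrite !inE ?(adj_sym G y) Gxy ?eqxx //= setUC.
Qed.

Lemma leq_card_bigcup (I U : finType) (F : I -> {set U}) :
  (#|\bigcup_i F i| <= \sum_i #|F i|)%N.
Proof.
apply: (big_ind2 (fun (A : {set U}) m => (#|A| <= m)%N)) => //.
  by rewrite cards0.
move=> A a B b hA hB; rewrite (leq_trans (leq_card_setU _ _).1) //.
exact: leq_add.
Qed.

Definition colour_class G (r : nat) (c : {set T} -> 'I_r) (i : 'I_r) : rel T :=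
  fun x y => G x y && (c [set x; y] == i).

Lemma colour_class_sym G r (c : {set T} -> 'I_r) i :
  symmetric (colour_class G c i).
Proof. by move=> x y; rewrite /colour_class (adj_sym G) setUC. Qed.

(** Exactly [m] edges are demanded, so a larger matching is truncated. *)
Lemma has_mono_matching_inv G r (c : {set T} -> 'I_r) i m f :
  inv_matching (colour_class G c i) f -> (2 * m <= #|covered f|)%N ->
  has_mono_matching G c i m.
Proof.
move=> /inv_matchingP[ff fE]; rewrite card_covered // leq_pmul2l // => le_m.
exists [set e in take m (enum (edge_set f))].
have sub : [set e in take m (enum (edge_set f))] \subset edge_set f.
  by apply/subsetP=> e; rewrite inE => /mem_take; rewrite mem_enum.
have edge_col e : e \in edge_set f -> (e \in edges G) && (c e == i).
  case/imsetP=> x; rewrite inE => /fE /andP[Gx ce] ->; rewrite ce andbT.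
  by apply/imsetP; exists (x, f x); rewrite ?inE.
split.
- rewrite /matching (trivIsetS sub (edge_set_triv ff)) andbT.
  by apply/subsetP=> e /(subsetP sub) /edge_col /andP[].
- rewrite cardsE (card_uniqP _) ?take_uniq ?enum_uniq // size_take -cardE.
  by move: le_m; rewrite leq_eqVlt => /orP[/eqP->|->//]; rewrite ltnn.
- by move=> e /(subsetP sub) /edge_col /andP[_ /eqP].
Qed.

(** An adjacent pair either has an end outside [W] or avoids [S i] for its own colour [i]. The pairs
    of the first kind are bounded as if [G] were complete there. *)
Lemma colour_pairs_bound G r (c : {set T} -> 'I_r) (S : 'I_r -> {set T})
    (W := ~: \bigcup_i S i) :
  (2 * #|edges G| + #|offdiag_in W| <= #|offdiag_in [set: T]| +
    \sum_i #|offdiag (avoiding (colour_class G c i) (S i))|)%N.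
Proof.
have WT : offdiag_in W \subset offdiag_in [set: T].
  by apply/subsetP=> p; rewrite !inE => /and3P[].
have := cardsID (offdiag_in W) (offdiag_in [set: T]).
rewrite (setIidPr WT) => <-; rewrite addnC -addnA leq_add2l.
apply: leq_trans (double_card_edges G) _.
apply: leq_trans (leq_add (leqnn _) (leq_card_bigcup _)).
apply: leq_trans (leq_card_setU _ _).1.
apply: subset_leq_card; apply/subsetP=> -[x y]; rewrite !inE /= => Gxy.
have -> : x != y by apply/eqP=> h; move: Gxy; rewrite h (adj_irrefl G).
rewrite !andbT -negb_or negbK.
have [//|h] := boolP (_ || (y \in _)).
apply/bigcupP; exists (c [set x; y]) => //.
move: h; rewrite negb_or => /andP[xS yS].
rewrite !inE /= /avoiding /colour_class Gxy eqxx /= -andbA; apply/and3P; split.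
- by apply: contra xS => xS; apply/bigcupP; exists (c [set x; y]).
- by apply: contra yS => yS; apply/bigcupP; exists (c [set x; y]).
- by apply/eqP=> h; move: Gxy; rewrite h (adj_irrefl G).
Qed.

End Counting.

(** * The numerical inequality *)

Local Open Scope ring_scope.

(** To be used with [K] the maximum of the [k i - 1], [M0] their sum, [M] the sum of the [m i], and
    [w] the number of vertices outside all [S i]. The alternative [K = 0 \/ 1 <= K] retains the
    integrality of [K]. *)
Lemma pair_count_contradiction (R : realFieldType) (r n delta K M0 M w : R) :
  2 <= r -> 0 <= delta -> 2 * (r + 1) * delta <= 1 ->
  0 <= M -> M <= M0 -> (K = 0 \/ 1 <= K) -> K <= M0 -> M0 <= r * K ->
  M0 + K + 2 <= (1 - (r + 1) * delta) * n -> n - (M0 - M) <= w ->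
  (1 - delta) * (n * (n - 1)) + w * (w - 1) <=
    n * (n - 1) + 2 * M * (2 * K + 1) ->
  False.
Proof.
move=> hr d0 d1 hM0 hM hK KM0 M0K hn hw h.
have K0 : 0 <= K by case: hK => [->|]; lra.
have ad0 : 0 <= (r + 1) * delta by nra.
have n0 : 0 <= n.
  by rewrite leNgt; apply/negP=> n0; nra.
have an0 : 0 <= (r + 1) * delta * n by nra.
have w1 : M + K + 2 + (r + 1) * delta * n <= w by lra.
(* For large [M + K], use [(M + K) ^ 2 >= 4 * M * K] and the excess
   [(r + 1) * delta * n] of [w] over [M + K]; otherwise [w > n / 2], which leaves
   room for [delta * n ^ 2] without that excess. *)
have [big|small] := leP n (2 * (r + 1) * (M + K)).
  set e := 2 + (r + 1) * delta * n in w1 *.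
  have le_w : (M + K + e) * (M + K + e - 1) <= w * (w - 1).
    by apply: ler_pM; rewrite /e; lra.
  have d_n : delta * n * n <= delta * n * (2 * (r + 1) * (M + K)).
    by apply: ler_wpM2l => //; apply: mulr_ge0.
  have sq : 0 <= (M - K) ^+ 2 by apply: sqr_ge0.
  have e2 : 2 <= e by rewrite /e; lra.
  have ee : 2 <= e * (e - 1) by nra.
  have dn : 0 <= delta * n by apply: mulr_ge0.
  rewrite /e in le_w ee; nra.
(* If [K = 0], then [M = 0] and [w >= n], and [h] leaves no room for
   [(1 - delta) * (n * (n - 1)) > 0]. Otherwise [1 <= K <= M0] yields [n >= 4], on which [gap] below
   rests. *)
case: hK => [K00|K1].
  have M00 : M0 = 0 by subst K; lra.
  have MM : M = 0 by lra.
  have n2 : 2 <= n by lra.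
  have d6 : delta <= 1 / 2 by nra.
  have : n * (n - 1) <= w * (w - 1) by apply: ler_pM; lra.
  have : 0 < n * (n - 1) by apply: mulr_gt0; lra.
  subst K M; nra.
have n4 : 4 <= n by lra.
(* In this unit the case assumption reads [M + K < A] and the bound on [delta] gives
   [delta * n <= A]. Since [M0 <= r * K <= r * A], also [w >= n - r * A = (r + 2) * A]. *)
pose A := n / (2 * (r + 1)).
have nA : n = 2 * (r + 1) * A by rewrite /A mulrC divfK //; lra.
have A0 : 0 < A by rewrite /A divr_gt0 //; lra.
have MKA : M + K < A by rewrite nA in small; nra.
have wA : (r + 2) * A <= w by nra.
have rA : 2 <= (r + 1) * A by lra.
have le_w : (r + 2) * A * ((r + 2) * A - 1) <= w * (w - 1).
  by apply: ler_pM; lra.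
have dA : delta * n <= A by nra.
have MK : 4 * M * K <= A * A.
  have : 0 <= (M - K) ^+ 2 by apply: sqr_ge0.
  have : (M + K) * (M + K) <= A * A by apply: ler_pM; lra.
  nra.
have dn : delta * n * (n - 1) <= A * (n - 1) by apply: ler_wpM2r; lra.
have rrA : (r + 1) * 2 <= (r + 1) * ((r + 1) * A) by apply: ler_wpM2l; lra.
(* This is the lower bound [(r + 2) * A * ((r + 2) * A - 1)] for [w * (w - 1)] minus the upper bound
   [A * (n - 1) + A * A + 2 * A] that [h] implies. *)
have gap : 0 < A * ((r + 1) * ((r + 1) * A) - (r + 3)) by apply: mulr_gt0; lra.
have An : A * n = 2 * (r + 1) * A * A by rewrite [in LHS]nA; lra.
clear - le_w MK dn gap An h MKA K0.
lra.
Qed.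

(** * From the bounds for the single colours to the numerical inequality *)

Theorem theorem1p3 (R : realFieldType) (r : nat) (hr : (2 <= r)%N)
    (k : 'I_r -> nat) (hk : forall i : 'I_r, (1 <= k i)%N)
    (delta : R) (hdelta0 : 0 <= delta)
    (hdelta1 : delta <= 1 / (2%:R * (r + 1)%:R))
    (n : nat) (T : finType) (hn : #|T| = n) (G : sgraph T)
    (hG : (1 - delta) * 'C(n, 2)%:R <= #|edges G|%:R)
    (hkn : \sum_(i < r) ((k i)%:R - 1) + (\max_(i < r) k i)%N%:R + 1
             <= (1 - (r + 1)%:R * delta) * n%:R) :
  forall c : {set T} -> 'I_r,
    exists i : 'I_r, has_mono_matching G c i (k i).
Proof.
move=> c.
case: (boolP [exists i, exists f : {ffun T -> T},
    inv_matching (colour_class G c i) f && (2 * k i <= #|covered f|)%N]).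
  case/existsP=> i /existsP[f /andP[mf kf]].
  by exists i; apply: has_mono_matching_inv mf kf.
rewrite negb_exists => /forallP nomatch; exfalso.
have cov_le i f : inv_matching (colour_class G c i) f ->
    (#|covered f| <= 2 * (k i).-1)%N.
  move=> mf; have := nomatch i; rewrite negb_exists => /forallP/(_ f).
  rewrite mf /= -ltnNge; have [/card_covered-> _] := inv_matchingP _ _ mf.
  by rewrite ltn_pmul2l // leq_pmul2l // -{1}(prednK (hk i)).
have /fin_all_exists[S] := fun i =>
  tutte_berge_pairs (colour_class_sym G c i) (cov_le i).
case/fin_all_exists=> m Sm.
have := colour_pairs_bound G c S; set W := ~: _ => /= bound.
pose K := (\max_(i < r) k i).-1.
pose M := (\sum_(i < r) m i)%N; pose M0 := (\sum_(i < r) (k i).-1)%N.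
have kK i : ((k i).-1 <= K)%N.
  by rewrite /K -!subn1; apply: leq_sub2r; apply: leq_bigmax.
have mK i : (m i <= K)%N by apply: leq_trans (kK i); have [] := Sm i; lia.
have MM0 : (M <= M0)%N by apply: leq_sum => i _; have [] := Sm i; lia.
have KM0 : (K <= M0)%N.
  have [i iK] : {i | (\max_(i < r) k i)%N = k i}.
    by apply: bigop.eq_bigmax; rewrite card_ord (ltn_trans _ hr).
  by rewrite /K iK /M0 (bigD1 i) //= leq_addr.
have M0K : (M0 <= r * K)%N.
  rewrite -[r in X in (_ <= X)%N]card_ord -sum_nat_const.
  by apply: leq_sum.
(* The union of the [S i] has at most [M0 - M] elements, by summing [#|S i| + m i <= (k i).-1]. *)
have Wn : (n <= #|W| + (M0 - M))%N.
  rewrite -hn -(cardsC (\bigcup_i S i)) addnC leq_add2l.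
  apply: leq_trans (leq_card_bigcup _) _.
  rewrite leq_subRL // -big_split; apply: leq_sum => i _ /=.
  by rewrite addnC; have [] := Sm i.
have pairsM : (\sum_i #|offdiag (avoiding (colour_class G c i) (S i))| <=
    2 * M * (2 * K + 1))%N.
  rewrite /M big_distrr big_distrl /=; apply: leq_sum => i _.
  have [_ /leq_trans->//] := Sm i.
  by rewrite leq_mul2l leq_add2r leq_mul2l mK !orbT.
have maxK : (\max_(i < r) k i = K.+1)%N.
  rewrite prednK //; apply: leq_trans (hk (Ordinal hr)) _; exact: leq_bigmax.
have nbin : n%:R * (n%:R - 1) = 2 * 'C(n, 2)%:R :> R.
  have -> : 2 * 'C(n, 2)%:R = (n * n.-1)%:R :> R.
    by rewrite -natrM -[2%N in LHS]/(2`!) mulnC bin_ffact ffactnS ffactn1.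
  by case: (n) => [|n']; rewrite ?mul0r // natrM /= -natr1 addrK.
have sumk : \sum_(i < r) ((k i)%:R - 1) = M0%:R :> R.
  rewrite natr_sum; apply: eq_bigr => i _.
  by rewrite -[in LHS](prednK (hk i)) -natr1 addrK.
apply: (@pair_count_contradiction R r%:R n%:R delta
  K%:R M0%:R M%:R #|W|%:R) => //.
- by rewrite ler_nat.
- move: hdelta1; rewrite ler_pdivlMr.
    by rewrite natrD mulrC.
  by rewrite -natrM ltr0n muln_gt0 addn1.
- by rewrite ler_nat.
- by case: (K) => [|K']; [left | right; rewrite ler1n].
- by rewrite ler_nat.
- by rewrite -natrM ler_nat.
- move: hkn; rewrite sumk maxK natrD -natr1; lra.
- by rewrite -natrB // lerBlDr -natrD ler_nat.
have sqW := card_offdiag_in W; have sqT := card_offdiag_in [set: T].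
have sq (a : nat) (b : nat) : (a + b = b * b)%N ->
    b%:R * (b%:R - 1) = a%:R :> R.
  by move=> e; rewrite mulrBr mulr1 -natrM -e natrD addrK.
rewrite cardsT hn in sqT; rewrite (sq _ _ sqW).
have le_nat : (2 * #|edges G| + #|offdiag_in W| <= #|offdiag_in [set: T]| +
    2 * M * (2 * K + 1))%N by rewrite (leq_trans bound) // leq_add2l.
move: le_nat; rewrite -(ler_nat R) !natrD !natrM natrD natrM.
rewrite -(sq _ _ sqT) => le_R.
apply: le_trans le_R; rewrite lerD2r nbin; move: hG; lra.
Qed.
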